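(* Let $r\ge2$ be fixed. There is a number $d_0=d_0(r)$ such that the following holds. Let $d$ be an integer with $d\ge d_0$ and let $n\ge r^5d^4$. Then there is a simple $d$-regular $r$-partite $r$-uniform hypergraph $G$ with $n$ vertices in each class having properties $I(r,n,d)$ and $D(r,n,d)$.
   Context: An $r$-partite $r$-uniform hypergraph has vertex set $V=V_1\cup\cdots\cup V_r$ (disjoint classes, each of size $n$) and each edge contains exactly one vertex of each $V_i$. It is simple if distinct edges share at most one vertex. For $X\subseteq V$ write $X_i=X\cap V_i$ and $i_X=\min\{i:|X_i|=\max_j|X_j|\}$. A set $X$ is independent if it contains no edge; $X$ is $k$-degenerate if for every nonempty $Y\subseteq X$ the induced subhypergraph $G[Y]$ has a vertex of degree at most $k$. For real $d$ with $1\le d\le n^{r-1}$: $G$ has property $I(r,n,d)$ if every independent set $X$ satisfies $\prod_{i\ne i_X}|X_i|<\frac{n^{r-1}}{d}\log^2 d$; $G$ has property $D(r,n,d)$ if every set $X$ with $\prod_{i\ne i_X}|X_i|<\frac{n^{r-1}}{d}$ is $(4\log d/\log\log d)$-degenerate. $\log$ is the natural logarithm. *)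

(* Defs.v *)
From mathcomp Require Import all_boot all_order all_algebra.
From mathcomp Require Import reals exp.

Set Implicit Arguments.
Unset Strict Implicit.
Unset Printing Implicit Defensive.

Import Order.TTheory GRing.Theory Num.Theory.

Local Open Scope ring_scope.

(* The vertex (i, j) is the j-th vertex of the class V_i, so the r classes are
   disjoint and have n vertices each. *)
Definition vertex (r n : nat) : finType := ('I_r * 'I_n)%type.

(* A hypergraph is its set of edges; all hypergraphs live on [vertex r n]. *)
Definition hypergraph (r n : nat) := {set {set vertex r n}}.

(* X_i, the intersection of X with the class V_i *)
Definition part (r n : nat) (X : {set vertex r n}) (i : 'I_r) :
  {set vertex r n} := [set v in X | v.1 == i].

(* This entails r-uniformity. *)
Definition partite (r n : nat) (G : hypergraph r n) : Prop :=
  forall e, e \in G -> forall i : 'I_r, #|part e i| = 1%N.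

Definition simple_hypergraph (r n : nat) (G : hypergraph r n) : Prop :=
  forall e f, e \in G -> f \in G -> e != f -> (#|e :&: f| <= 1)%N.

Definition degree (r n : nat) (G : hypergraph r n) (v : vertex r n) : nat :=
  #|[set e in G | v \in e]|.

Definition regular (r n : nat) (d : nat) (G : hypergraph r n) : Prop :=
  forall v, degree G v = d.

(* G[Y]; the vertices outside Y stay in the type, as isolated vertices. *)
Definition induced (r n : nat) (G : hypergraph r n) (Y : {set vertex r n}) :
  hypergraph r n := [set e in G | e \subset Y].

Definition independent (r n : nat) (G : hypergraph r n)
    (X : {set vertex r n}) : Prop :=
  forall e, e \in G -> ~~ (e \subset X).

Definition degenerate (R : realType) (r n : nat) (G : hypergraph r n) (k : R)
    (X : {set vertex r n}) : Prop :=
  forall Y : {set vertex r n}, Y \subset X -> Y != set0 ->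
    exists2 v, v \in Y & (degree (induced G Y) v)%:R <= k.

(* i_X as a natural number: [enum 'I_r] lists the indices in increasing order,
   so [find] returns the least one attaining the maximum (for r > 0). *)
Definition imax (r n : nat) (X : {set vertex r n}) : nat :=
  find (fun i : 'I_r => #|part X i| == \max_(j < r) #|part X j|)
       (enum 'I_r).

Definition prod_others (r n : nat) (X : {set vertex r n}) : nat :=
  (\prod_(i < r | (i : nat) != imax X) #|part X i|)%N.

(* The properties I(r, n, d) and D(r, n, d), for real 1 <= d <= n ^ (r - 1). *)
Definition property_I (R : realType) (r n : nat) (d : R)
    (G : hypergraph r n) : Prop :=
  forall X : {set vertex r n}, independent G X ->
    (prod_others X)%:R < n%:R ^+ r.-1 / d * ln d ^+ 2.

Definition property_D (R : realType) (r n : nat) (d : R)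
    (G : hypergraph r n) : Prop :=
  forall X : {set vertex r n}, (prod_others X)%:R < n%:R ^+ r.-1 / d ->
    degenerate G (4 * ln d / ln (ln d)) X.

(* Main.v *)
Require Import Defs.
From mathcomp Require Import all_boot all_order all_algebra all_fingroup.
From mathcomp Require Import reals sequences exp.
From mathcomp Require Import zify ring lra.

(* Take the union of [d] random perfect matchings, uniformly among all
   [d]-tuples of labelled matchings whose union is simple. If [x] is the label
   of the edge of the [j]-th matching through a fixed vertex of the class
   [V_i0], exchange, for every [i != i0], the class-[i] vertices of the edges
   with labels [x] and [y i]. Since a vertex has at most [d] neighbours in
   each class, most choices of [y] keep the union simple, and double counting
   these switchings shows that, whatever the edges of the [j]-th matching
   through few other vertices of [V_i0] are, the edge with label [x] behaves,
   up to a factor [2 ^ r], like a uniformly random one.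

   Exposing the edges at a quarter of the smallest class of [X] bounds the
   probability that [X] is independent by [exp (- c |X| log^2 d)]. Exposing
   edges at the largest class of [Y], of size [m], bounds the probability that
   [Y] has minimum degree at least [k] by [((e 2^r / k) delta)^(k m)], where
   [delta = d prod_{i <> i_Y} |Y_i| / n^(r-1)]; here [delta < 1] and
   [delta <= d (m / n)^(r-1)]. Both bounds are summed over all sets by
   comparison with [sum_Y z^|Y| = (1 + z)^(r n)]. *)

Set Implicit Arguments.
Unset Strict Implicit.
Unset Printing Implicit Defensive.

Import Order.TTheory GRing.Theory Num.Theory.

(** * Switchings *)

Lemma card_union_bound (T I : finType) (A : {set T}) (P : pred I)
    (F : I -> {set T}) :
  (forall x, x \in A -> exists2 i, P i & x \in F i) ->
  (#|A| <= \sum_(i | P i) #|F i|)%N.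
Proof.
move=> AF; apply: (@leq_trans #|\bigcup_(i | P i) F i|).
  by apply/subset_leq_card/subsetP => x /AF[i Pi xFi]; apply/bigcupP; exists i.
elim/big_rec2: _ => [|i m B _ leBm]; first by rewrite cards0.
by rewrite (leq_trans (leq_card_setU _ _))// leq_add2l.
Qed.

(** Double counting: [(t, u) |-> (f t u, u)] is injective, because applying [f] again with the same
    [u] recovers [t]. *)
Lemma sum_card_switch (T U : finType) (P P' : {set T}) (Q Q' : T -> {set U})
    (f : T -> U -> T) :
  (forall t u, t \in P -> u \in Q t ->
     [/\ f t u \in P', u \in Q' (f t u) & f (f t u) u = t]) ->
  (\sum_(t in P) #|Q t| <= \sum_(t in P') #|Q' t|)%N.
Proof.
move=> fP.
have cardE (S : {set T}) (V : T -> {set U}) :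
    \sum_(t in S) #|V t| = #|[set q | (q.1 \in S) && (q.2 \in V q.1)]|.
  under eq_bigr do rewrite -sum1_card.
  by rewrite pair_big_dep -sum1_card; apply: eq_bigl => q; rewrite inE.
rewrite !cardE -(@card_in_imset _ _ (fun q => (f q.1 q.2, q.2))).
  apply/subset_leq_card/subsetP => _ /imsetP[[t u] + ->].
  by rewrite !inE /= => /andP[tP uQ]; have [-> -> _] := fP _ _ tP uQ.
move=> [t u] [t' u']; rewrite !inE /= => /andP[tP uQ] /andP[tP' uQ'] [ft eu].
rewrite -{}eu in uQ' ft *.
by have [_ _ <-] := fP _ _ tP uQ; have [_ _ <-] := fP _ _ tP' uQ'; rewrite ft.
Qed.

Definition box (I T : finType) (C : I -> {set T}) : {set {ffun I -> T}} :=
  [set y : {ffun I -> T} | [forall i, y i \in C i]].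

Lemma card_box (I T : finType) (C : I -> {set T}) :
  #|box C| = \prod_i #|C i|.
Proof.
rewrite (_ : #|box C| = #|(family (fun i => mem (C i)) : simpl_pred {ffun I -> T})|).
  by rewrite card_family foldrE big_map big_enum.
by apply: eq_card => y; rewrite inE; apply/forallP/familyP.
Qed.

(** A union bound over the pairs of coordinates: each of the at most [#|I| ^ 2] pairs spoils at most
    a fraction [1 / (2 #|I| ^ 2)] of the box. The coordinate [i0] is exempt from the size condition
    because it will be a singleton. *)
Lemma card_box_avoid (I T : finType) (C : I -> {set T}) (i0 : I)
    (R : I -> I -> rel T) D :
  (forall i i' a, i != i' -> i' != i0 -> a \in C i ->
     #|[set b in C i' | R i i' a b]| <= D) ->
  (forall i', i' != i0 -> 2 * #|I| ^ 2 * D <= #|C i'|) ->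
  \prod_i #|C i| <= 2 * #|[set y in box C | [forall i, forall i',
      (i != i') && (i' != i0) ==> ~~ R i i' (y i) (y i')]]|.
Proof.
move=> CR CD; set G := [set y in box C | _].
pose bad q := [set y in box C | R q.1 q.2 (y q.1) (y q.2)].
pose cond (q : I * I) := (q.1 != q.2) && (q.2 != i0).
have card_bad q : cond q -> 2 * #|I| ^ 2 * #|bad q| <= \prod_i #|C i|.
  case: q => i i' /andP[/= ii' i'0].
  pose C' a k := if k == i then [set a] else
                 if k == i' then [set b in C i' | R i i' a b] else C k.
  have /leq_trans-> // : 2 * #|I| ^ 2 * #|bad (i, i')| <=
      2 * #|I| ^ 2 * \sum_(a in C i) #|box (C' a)|.
    rewrite leq_mul2l; apply/orP; right; apply: card_union_bound => y.
    rewrite !inE /= => /andP[/forallP yC Ry]; exists (y i) => //.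
    rewrite inE; apply/forallP => k; rewrite /C'; case: eqP => [->|_].
      by rewrite set11.
    by case: eqP => [->|//]; rewrite inE yC.
  pose p := \prod_(k | (k != i) && (k != i')) #|C k|.
  have card_C' a : a \in C i -> #|box (C' a)| <= D * p.
    move=> aC; rewrite card_box (bigD1 i)//= (bigD1 i')/=; last by rewrite eq_sym.
    rewrite {1 2}/C' eqxx cards1 mul1n eq_sym (negPf ii') eqxx leq_mul//.
      exact: CR.
    by rewrite leq_eqVlt; apply/orP; left; apply/eqP/eq_bigr => k /andP[
      /negPf ki /negPf ki']; rewrite /C' ki ki'.
  have /(leq_mul (leqnn (2 * #|I| ^ 2)))/leq_trans-> // := leq_sum (index_enum _) card_C'.
  rewrite sum_nat_const (bigD1 i)//= (bigD1 i')/=; last by rewrite eq_sym.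
  rewrite mulnCA leq_mul2l; apply/orP; right; rewrite -/p mulnA leq_mul2r.
  by rewrite CD// orbT.
have boxG : #|box C| <= #|G| + \sum_(q | cond q) #|bad q|.
  rewrite -(cardsID G) leq_add ?subset_leq_card ?subsetIr//.
  apply: card_union_bound => y /setDP[yC]; rewrite inE yC/=.
  rewrite negb_forall => /existsP[i]; rewrite negb_forall => /existsP[i'].
  rewrite negb_imply negbK => /andP[ii' Ry]; exists (i, i') => //.
  by rewrite inE yC.
have : 2 * #|I| ^ 2 * \sum_(q | cond q) #|bad q| <= #|I| ^ 2 * \prod_i #|C i|.
  rewrite big_distrr/= (leq_trans (leq_sum (index_enum _) card_bad))// sum_nat_const.
  rewrite leq_mul2r; apply/orP; right.
  by rewrite (leq_trans (max_card _))// card_prod mulnn.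
have : 0 < #|I| ^ 2 by rewrite expn_gt0; apply/orP; left; apply/card_gt0P; exists i0.
move: boxG; rewrite card_box; case: (#|I| ^ 2) => // c; nia.
Qed.

(** * Systems of matchings and the switching operation *)

Section Switching.
Variables (r n d : nat).

(* A [d]-tuple of perfect matchings with edges labelled by ['I_n]:
   [w (j, i) x] is the vertex in the class [i] of the edge with label [x] of
   the [j]-th matching. *)
Definition system : finType := {ffun 'I_d * 'I_r -> 'S_n}.
Implicit Types (w : system) (j : 'I_d) (i : 'I_r) (x z a b v : 'I_n).

(** Leaving out the [j]-th matching makes this relation insensitive to switchings in that
    matching. *)
Definition joined w j i a i' b :=
  [exists j', (j' != j) && [exists z, (w (j', i) z == a) && (w (j', i') z == b)]].

(** The systems with simple union: edges of one matching are disjoint, so only different matchings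
    have to be compared. *)
Definition admissible : {set system} :=
  [set w : system | [forall j, forall z, forall i, forall i',
     (i != i') ==> ~~ joined w j i (w (j, i) z) i' (w (j, i') z)]].

Lemma admissibleP w :
  reflect (forall j j' i i' z z', j != j' -> i != i' ->
    w (j, i) z = w (j', i) z' -> w (j, i') z <> w (j', i') z')
    (w \in admissible).
Proof.
rewrite inE; apply: (iffP idP) => [wP j j' i i' z z' jj' ii' e e'|wP].
  move/forallP/(_ j)/forallP/(_ z)/forallP/(_ i)/forallP/(_ i'): wP.
  rewrite ii' => /negP[]; apply/existsP; exists j'; rewrite eq_sym jj'.
  by apply/existsP; exists z'; rewrite e e' !eqxx.
apply/forallP => j; apply/forallP => z; apply/forallP => i; apply/forallP => i'.
apply/implyP => ii'; apply/negP => /existsP[j' /andP[jj']].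
move=> /existsP[z' /andP[/eqP e /eqP e']].
by apply: (wP j' j i i' z' z) => //.
Qed.

Lemma joinedC w j i a i' b : joined w j i a i' b = joined w j i' b i a.
Proof. by apply: eq_existsb => j'; congr andb; apply: eq_existsb => z; rewrite andbC. Qed.

Lemma card_joined w j i a i' : #|[set b | joined w j i a i' b]| <= d.
Proof.
rewrite -[d in _ <= d]card_ord -cardsT.
apply: leq_trans (leq_imset_card (fun j' => w (j', i') ((w (j', i))^-1%g a)) _).
apply/subset_leq_card/subsetP => b; rewrite inE => /existsP[j' /andP[_]].
move=> /existsP[z /andP[/eqP <- /eqP <-]]; apply/imsetP; exists j' => //.
by rewrite permK.
Qed.

Definition switch w j x (y : 'I_r -> 'I_n) : system :=
  [ffun q : 'I_d * 'I_r => if q.1 == j then (tperm x (y q.2) * w q)%g else w q].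

Lemma switchE w j x y j' i z :
  switch w j x y (j', i) z =
  w (j', i) (if j' == j then tperm x (y i) z else z).
Proof. by rewrite ffunE/=; case: eqP => // _; rewrite permM. Qed.

Lemma switchK w j x y : switch (switch w j x y) j x y = w.
Proof.
apply/ffunP => -[j' i]; apply/permP => z; rewrite !switchE.
by case: eqP => // _; rewrite tpermK.
Qed.

(** The edge [x] receives the vertices of the edges [y i], which gives the first condition. The edge
    [y i] receives one vertex of the edge [x] and keeps its vertices in the classes that are not
    exchanged, which gives the second. *)
Lemma switch_admissible w j x y : w \in admissible ->
  (forall i i', i != i' -> ~~ joined w j i (w (j, i) (y i)) i' (w (j, i') (y i'))) ->
  (forall i i', i != i' -> ~~ joined w j i (w (j, i) x) i' (w (j, i') (y i))) ->
  switch w j x y \in admissible.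
Proof.
move=> /admissibleP wA yy xy.
have unjoined i i' z : i != i' ->
    ~~ joined w j i (switch w j x y (j, i) z) i' (switch w j x y (j, i') z).
  move=> ii'; rewrite !switchE eqxx.
  case: (tpermP x (y i) z) => [->|->|/eqP zx /eqP zy].
  - by rewrite tpermL; apply: yy.
  (* If [y i' = y i], the label carries two vertices of the old edge [x], which [w] already keeps
     unjoined. *)
  - case: tpermP => [e|_|_ _]; last exact: xy.
      by rewrite -e; apply: yy => //.
    apply/negP => /existsP[j' /andP[jj' /existsP[z' /andP[/eqP e /eqP e']]]].
    exact: (wA j' j i i' z' x).
  - case: (tpermP x (y i') z) => [zx'|->|_ _].
    + by rewrite zx' eqxx in zx.
    + by rewrite joinedC; apply: xy; rewrite eq_sym.
    + apply/negP => /existsP[j' /andP[jj' /existsP[z' /andP[/eqP e /eqP e']]]].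
      exact: (wA j' j i i' z' z).
apply/admissibleP => j1 j2 i i' z z' j12 ii'.
have [j1j|j1j] := eqVneq j1 j.
  subst j1; have /negP U := unjoined i i' z ii' => e e'; apply: U.
  apply/existsP; exists j2; rewrite eq_sym j12/=; apply/existsP; exists z'.
  by rewrite e e' !switchE [j2 == j]eq_sym (negPf j12) !eqxx.
have [j2j|j2j] := eqVneq j2 j.
  subst j2; have /negP U := unjoined i i' z' ii' => e e'; apply: U.
  apply/existsP; exists j1; rewrite j12/=; apply/existsP; exists z.
  by rewrite -e -e' !switchE (negPf j12) !eqxx.
by rewrite !switchE (negPf j1j) (negPf j2j); apply: wA.
Qed.

Definition label w i0 (p : 'I_d * 'I_n) : 'I_n := ((w (p.1, i0))^-1)%g p.2.

(* The vertex in the class [i] of the edge of the [p.1]-th matching through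
   the vertex [(i0, p.2)]. *)
Definition nbr w i0 (p : 'I_d * 'I_n) i : 'I_n := w (p.1, i) (label w i0 p).

Lemma label_switch w i0 j x y p : y i0 = x ->
  label (switch w j x y) i0 p = label w i0 p.
Proof.
move=> yx; rewrite /label; congr (fun s : 'S_n => (s^-1)%g p.2).
by apply/permP => z; rewrite switchE yx tperm1 perm1 if_same.
Qed.

Lemma nbr_switch w i0 j x y p i : y i0 = x ->
  (p.1 = j -> label w i0 p != x /\ label w i0 p != y i) ->
  nbr (switch w j x y) i0 p i = nbr w i0 p i.
Proof.
move=> yx pj; rewrite /nbr label_switch// switchE.
by case: eqP => // /pj[]; rewrite ![label _ _ _ == _]eq_sym => ? ?; rewrite tpermD.
Qed.

Definition edge_in w i0 (A : 'I_r -> {set 'I_n}) p :=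
  [forall i, (i != i0) ==> (nbr w i0 p i \in A i)].

(* [T] holds the vertices of the class [i0] whose edges are already exposed;
   [P] is an event that depends on these edges only. *)
Lemma switching i0 (p : 'I_d * 'I_n) (T : {set 'I_d * 'I_n})
    (P : {set system}) (A B : 'I_r -> {set 'I_n}) :
  P \subset admissible -> p \notin T ->
  (forall w w', w \in P -> w' \in admissible ->
     (forall t i, t \in T -> nbr w' i0 t i = nbr w i0 t i) -> w' \in P) ->
  (forall i, i != i0 -> 4 * #|[set v | (p.1, v) \in T]| <= #|B i|) ->
  (forall i, i != i0 -> 4 * r ^ 2 * d <= #|B i|) ->
  #|[set w in P | edge_in w i0 A p]| * \prod_(i | i != i0) #|B i| <=
  2 ^ r * (#|[set w in P | edge_in w i0 B p]| * \prod_(i | i != i0) #|A i|).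
Proof.
move=> PA pT PT TB dB; set j := p.1; set U := [set v | (j, v) \in T].
(* [used] holds the labels of the exposed edges of the [j]-th matching, which must stay intact;
   [bad w i] holds the labels whose edges could not accept the class-[i] vertex of the edge through
   [p]. *)
pose used w := [set label w i0 (j, v) | v in U].
pose bad w i := \bigcup_(i' | i' != i)
  [set z | joined w j i (w (j, i) (label w i0 p)) i' (w (j, i') z)].
(* The singleton at [i0] forces [y i0] to be the switched label itself, so that the class [i0] is
   not permuted. *)
pose C w i := if i == i0 then [set label w i0 p] else
  (w (j, i) @^-1: B i) :\: (used w :|: bad w i).
pose R w i i' a b := joined w j i (w (j, i) a) i' (w (j, i') b).
pose Q w := [set y in box (C w) | [forall i, forall i',
      (i != i') && (i' != i0) ==> ~~ R w i i' (y i) (y i')]].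
(* Switching back must return a class-[i] vertex in [A i]. Only an upper bound on the number of
   reverse switchings is needed, so nothing is avoided here. *)
pose Q' w := box (fun i => if i == i0 then [set label w i0 p] else
                           w (j, i) @^-1: A i).
have card_pre w i (S : {set 'I_n}) : #|w (j, i) @^-1: S| = #|S|.
  exact: card_preimset (@perm_inj _ _).
have card_bad w i : #|bad w i| <= r * d.
  apply: (@leq_trans (\sum_(i' | i' != i) d)); last first.
    rewrite sum_nat_const leq_mul2r; apply/orP; right.
    by rewrite -[r in _ <= r]card_ord max_card.
  apply: (@leq_trans (\sum_(i' | i' != i)
      #|[set b | joined w j i (w (j, i) (label w i0 p)) i' b]|)).
    apply: leq_trans (card_union_bound (P := fun i' => i' != i)
      (F := fun i' => [set z | joined w j i (w (j, i) (label w i0 p)) i' (w (j, i') z)]) _) _.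
      by move=> z /bigcupP[i' ii' zi']; exists i'.
    apply: leq_sum => i' _; rewrite -[leqRHS](card_pre w i').
    by apply: subset_leq_card; apply/subsetP => z; rewrite !inE.
  by apply: leq_sum => i' _; exact: card_joined.
(* Each of [used] and [bad] removes at most a quarter of the candidates. *)
have card_C w i : i != i0 -> #|B i| <= 2 * #|C w i|.
  move=> ii0; rewrite /C (negPf ii0) -(card_pre w i).
  set V := _ @^-1: _; have := cardsID (used w :|: bad w i) V.
  have : #|V :&: (used w :|: bad w i)| <= #|used w| + #|bad w i|.
    by rewrite (leq_trans _ (leq_card_setU _ _))// subset_leq_card// subsetIr.
  have : #|used w| <= #|U| := leq_imset_card _ _.
  have tb : 4 * #|U| <= #|V| by rewrite card_pre; exact: TB.
  have rd : 4 * (r * d) <= #|V|.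
    by rewrite card_pre (leq_trans _ (dB i ii0))//; case: (r) => // r'; nia.
  have := card_bad w i; move: tb rd.
  move: #|V :\: _| #|V :&: _| #|used w| #|bad w i| (r * d) #|U| #|V|; lia.
have step : \sum_(w in [set w in P | edge_in w i0 A p]) #|Q w| <=
            \sum_(w in [set w in P | edge_in w i0 B p]) #|Q' w|.
  apply: (sum_card_switch (f := fun w (y : {ffun 'I_r -> 'I_n}) => switch w j (label w i0 p) y)).
  move=> w y; rewrite !inE => /andP[wP /forallP wA] /andP[/forallP yC /forallP yR].
  have y0 : y i0 = label w i0 p by have := yC i0; rewrite /C eqxx inE => /eqP.
  have wadm := subsetP PA _ wP.
  have Rjoin i i' : i != i' -> i' != i0 -> ~~ R w i i' (y i) (y i').
    by move=> ii' i'0; have /forallP/(_ i')/implyP-> // := yR i; rewrite ii'.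
  have sw : switch w j (label w i0 p) y \in admissible.
    apply: switch_admissible => // i i' ii'.
      have [e|] := eqVneq i' i0; last exact: Rjoin.
      by rewrite joinedC; apply: Rjoin; rewrite -1?e// eq_sym.
    have [e|ii0] := eqVneq i i0.
      rewrite e y0; apply/negP => /existsP[j' /andP[jj']].
      move=> /existsP[z /andP[/eqP e1 /eqP e2]]; move: ii'; rewrite e => ii'.
      exact: (admissibleP _ wadm j' j i0 i' z (label w i0 p)).
    have := yC i; rewrite /C (negPf ii0) !inE negb_or => /andP[/andP[_ yb] _].
    by apply: contra yb => yb; apply/bigcupP; exists i'; rewrite 1?eq_sym ?inE.
  split.
  - rewrite (PT w)//=; last first.
      move=> t i tT; apply: nbr_switch => // tj.
      have tx : label w i0 t != label w i0 p.
        apply: contraNneq pT; rewrite /label tj => /perm_inj tp.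
        by rewrite -(_ : t = p)// [LHS]surjective_pairing tj tp [RHS]surjective_pairing.
      split=> //; have [->|ii0] := eqVneq i i0; first by rewrite y0.
      have := yC i; rewrite /C (negPf ii0) !inE negb_or => /andP[/andP[yu _] _].
      have tE : t = (j, t.2) by rewrite [LHS]surjective_pairing tj.
      apply: contraNneq yu => <-; rewrite tE; apply/imsetP; exists t.2 => //.
      by rewrite inE -tE.
    apply/forallP => i; apply/implyP => ii0.
    rewrite /nbr label_switch// switchE eqxx tpermL.
    by have := yC i; rewrite /C (negPf ii0) !inE => /andP[].
  - apply/forallP => i; case: eqP => [->|/eqP ii0].
      by rewrite label_switch// y0 set11.
    rewrite inE switchE eqxx tpermR; have := wA i; rewrite ii0; exact.
  - by rewrite label_switch// switchK.
have cardQ' w : #|Q' w| = \prod_(i | i != i0) #|A i|.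
  rewrite card_box (bigD1 i0)//= eqxx cards1 mul1n; apply: eq_bigr => i ii0.
  by rewrite (negPf ii0) card_pre.
(* A factor 2 is lost in each of the [r.-1] classes by [card_C], and one more by
   [card_box_avoid]. *)
have cardQ w : \prod_(i | i != i0) #|B i| <= 2 ^ r * #|Q w|.
  have prodC : \prod_(i | i != i0) #|B i| <= 2 ^ r.-1 * \prod_i #|C w i|.
    rewrite [\prod_i #|C w i|](bigD1 i0)//= {1}/C eqxx cards1 mul1n.
    apply: (@leq_trans (\prod_(i | i != i0) (2 * #|C w i|))).
      by apply: leq_prod => i; exact: card_C.
    rewrite big_split/= prod_nat_const (_ : #|_| = r.-1)//.
    by have := cardC1 i0; rewrite card_ord.
  have rS : r = r.-1.+1 by rewrite prednK// (leq_ltn_trans _ (ltn_ord i0)).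
  rewrite (leq_trans prodC)// [in 2 ^ r]rS expnSr -mulnA leq_mul2l.
  apply/orP; right; apply: (card_box_avoid (D := d)).
    move=> i i' a ii' i'0 aC.
    apply: leq_trans (card_joined w j i (w (j, i) a) i').
    rewrite -[leqRHS](card_pre w i'); apply/subset_leq_card/subsetP => z.
    by rewrite !inE => /andP[].
  move=> i' i'0; have := card_C w i' i'0; have := dB i' i'0; rewrite card_ord; lia.
rewrite -sum_nat_const.
apply: (@leq_trans (2 ^ r * \sum_(w in [set w in P | edge_in w i0 A p]) #|Q w|)).
  by rewrite big_distrr/=; apply: leq_sum => w _.
rewrite leq_mul2l; apply/orP; right; rewrite (leq_trans step)//.
by rewrite -sum_nat_const; apply: leq_sum => w _; rewrite cardQ'.
Qed.

(** * Exposing edges one at a time *)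

Lemma nbr_inj w i0 j i : injective (fun v => nbr w i0 (j, v) i).
Proof. by move=> v v' /perm_inj/perm_inj. Qed.

Definition all_in i0 A (T : {set 'I_d * 'I_n}) : {set system} :=
  [set w in admissible | [forall (t | t \in T), edge_in w i0 A t]].

Definition none_in i0 A (T : {set 'I_d * 'I_n}) : {set system} :=
  [set w in admissible | [forall (t | t \in T), ~~ edge_in w i0 A t]].

Lemma edge_in_nbr w w' i0 A t :
  (forall i, nbr w' i0 t i = nbr w i0 t i) -> edge_in w' i0 A t = edge_in w i0 A t.
Proof. by move=> ww'; apply: eq_forallb => i; rewrite ww'. Qed.

Lemma prod_classesT (i0 : 'I_r) :
  \prod_(i < r | i != i0) #|[set: 'I_n]| = n ^ r.-1.
Proof.
rewrite prod_nat_const cardsT card_ord (_ : #|_| = r.-1)//.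
by have := cardC1 i0; rewrite card_ord.
Qed.

(** Induction on [T]: switching from [A] to the full classes bounds the conditional probability of
    each new edge by [2 ^ r * \prod #|A i| / n ^ r.-1]. *)
Lemma card_all_in i0 i1 (A : 'I_r -> {set 'I_n}) (T : {set 'I_d * 'I_n}) :
  i1 != i0 -> 4 * #|A i1| <= n -> 4 * r ^ 2 * d <= n ->
  #|all_in i0 A T| * (n ^ r.-1) ^ #|T| <=
  #|admissible| * (2 ^ r * \prod_(i | i != i0) #|A i|) ^ #|T|.
Proof.
move=> i10 A1 rdn; have [m] := ubnP #|T|; elim: m => // m IHm in T *.
have [->|[p pT]] := set_0Vmem T.
  move=> _; rewrite cards0 !expn0 !muln1 subset_leq_card//.
  by apply/subsetP => w; rewrite inE => /andP[].
rewrite ltnS (cardsD1 p) pT add1n => Tm.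
set T' := T :\ p in Tm *.
have [->|[w0]] := set_0Vmem (all_in i0 A T); first by rewrite cards0.
rewrite inE => /andP[_ /forallP w0T].
(* In the system [w0], the exposed edges of one matching meet the class [i1] in distinct vertices of
   [A i1], so there are at most [n / 4] of them. *)
have used : 4 * #|[set v | (p.1, v) \in T']| <= n.
  apply: leq_trans A1; rewrite leq_mul2l/=.
  rewrite -(card_imset _ (@nbr_inj w0 i0 p.1 i1)).
  apply/subset_leq_card/subsetP => _ /imsetP[v + ->].
  rewrite !inE => /andP[_ vT]; have /implyP/(_ vT)/forallP/(_ i1) := w0T (p.1, v).
  by rewrite i10.
have /= := @switching i0 p T' (all_in i0 A T') A (fun=> setT).
rewrite prod_classesT => sw.
have {}sw : #|[set w in all_in i0 A T' | edge_in w i0 A p]| * n ^ r.-1 <=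
    2 ^ r * (#|all_in i0 A T'| * \prod_(i | i != i0) #|A i|).
  apply: leq_trans (sw _ _ _ _ _) _.
  - by apply/subsetP => w; rewrite inE => /andP[].
  - by rewrite !inE eqxx.
  - move=> w w'; rewrite !inE => /andP[_ /forallP wT] -> /= ww'; apply/forallP => t.
    by apply/implyP => tT; rewrite (edge_in_nbr _ (ww' t ^~ tT)); have := wT t; rewrite tT.
  - by move=> i _; rewrite cardsT card_ord.
  - by move=> i _; rewrite cardsT card_ord.
  rewrite leq_mul2l leq_mul2r; apply/orP; right; apply/orP; right.
  by apply/subset_leq_card/subsetP => w; rewrite inE => /andP[].
have sub : #|all_in i0 A T| <= #|[set w in all_in i0 A T' | edge_in w i0 A p]|.
  apply/subset_leq_card/subsetP => w; rewrite !inE => /andP[-> /forallP wT] /=.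
  apply/andP; split; last by have := wT p; rewrite pT.
  by apply/forallP => t; apply/implyP; rewrite !inE => /andP[_ tT]; have := wT t; rewrite tT.
have {IHm} := IHm _ Tm.
rewrite !expnS; move: ((n ^ r.-1) ^ #|T'|) ((2 ^ r * _) ^ #|T'|) => a b IH.
rewrite mulnA (@leq_trans (#|[set w in all_in i0 A T' | edge_in w i0 A p]| * n ^ r.-1 * a))//.
  by rewrite !leq_mul.
rewrite (leq_trans (leq_mul sw (leqnn a)))//.
move: (\prod_(i | i != i0) #|A i|) (2 ^ r) IH => e f IH; clear -IH.
have -> : f * (#|all_in i0 A T'| * e) * a = f * e * (#|all_in i0 A T'| * a).
  by rewrite -!mulnA; congr (_ * _); rewrite mulnCA.
by rewrite [leqRHS]mulnCA leq_mul.
Qed.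

(** Switching in the opposite direction, from the full classes to [A]: whatever was exposed, the
    next edge lies in [A] with probability at least [\prod #|A i| / (2 ^ r * n ^ r.-1)]. *)
Lemma card_none_in i0 (A : 'I_r -> {set 'I_n}) (T : {set 'I_d * 'I_n}) :
  (forall j i, i != i0 -> 4 * #|[set v | (j, v) \in T]| <= #|A i|) ->
  (forall i, i != i0 -> 4 * r ^ 2 * d <= #|A i|) ->
  #|none_in i0 A T| * (2 ^ r * n ^ r.-1) ^ #|T| <=
  #|admissible| * (2 ^ r * n ^ r.-1 - \prod_(i | i != i0) #|A i|) ^ #|T|.
Proof.
move=> TA dA; have [m] := ubnP #|T|; elim: m => // m IHm in T TA *.
have [->|[p pT]] := set_0Vmem T.
  move=> _; rewrite cards0 !expn0 !muln1 subset_leq_card//.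
  by apply/subsetP => w; rewrite inE => /andP[].
rewrite ltnS (cardsD1 p) pT add1n => Tm.
set T' := T :\ p in Tm *.
have TT' j : #|[set v | (j, v) \in T']| <= #|[set v | (j, v) \in T]|.
  by apply/subset_leq_card/subsetP => v; rewrite !inE => /andP[].
have /= := @switching i0 p T' (none_in i0 A T') (fun=> setT) A.
rewrite prod_classesT => sw.
have {}sw : #|none_in i0 A T'| * \prod_(i | i != i0) #|A i| <=
    2 ^ r * (#|[set w in none_in i0 A T' | edge_in w i0 A p]| * n ^ r.-1).
  apply: leq_trans (sw _ _ _ _ _).
  - rewrite leq_mul2r; apply/orP; right; apply/subset_leq_card/subsetP => w wP.
    by rewrite inE wP; apply/forallP => i; rewrite inE implybT.
  - by apply/subsetP => w; rewrite inE => /andP[].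
  - by rewrite !inE eqxx.
  - move=> w w'; rewrite !inE => /andP[_ /forallP wT] -> /= ww'; apply/forallP => t.
    by apply/implyP => tT; rewrite (edge_in_nbr _ (ww' t ^~ tT)); have := wT t; rewrite tT.
  - by move=> i ii0; rewrite (leq_trans _ (TA p.1 i ii0))// leq_mul2l TT'.
  - exact: dA.
have split : #|none_in i0 A T| + #|[set w in none_in i0 A T' | edge_in w i0 A p]|
    <= #|none_in i0 A T'|.
  rewrite -(cardsID [set w | edge_in w i0 A p] (none_in i0 A T')) addnC leq_add//.
    by apply/subset_leq_card/subsetP => w; rewrite !inE.
  apply/subset_leq_card/subsetP => w; rewrite !inE => /andP[-> /forallP wT] /=.
  apply/andP; split; first by have := wT p; rewrite pT.
  by apply/forallP => t; apply/implyP; rewrite !inE => /andP[_ tT]; have := wT t; rewrite tT.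
have step : #|none_in i0 A T| * (2 ^ r * n ^ r.-1) <=
    #|none_in i0 A T'| * (2 ^ r * n ^ r.-1 - \prod_(i | i != i0) #|A i|).
  (* The subtraction is not truncated, since the product is at most [n ^ r.-1]. *)
  rewrite mulnBr leq_subRL; last first.
    rewrite leq_mul2l (@leq_trans (n ^ r.-1)) ?orbT//.
      rewrite -(prod_classesT i0); apply: leq_prod => i _.
      by apply: subset_leq_card; exact: subsetT.
    by rewrite leq_pmull// expn_gt0.
  rewrite (leq_trans (leq_add sw (leqnn _)))//.
  by rewrite mulnCA -mulnDl addnC leq_mul.
have {}IHm : #|none_in i0 A T'| * _ <= _ := IHm T' _ Tm.
rewrite !expnS mulnA (leq_trans (leq_mul step (leqnn _)))//.
rewrite -mulnA mulnCA [leqRHS]mulnCA leq_mul// ?IHm//.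
by move=> j i ii0; rewrite (leq_trans _ (TA j i ii0))// leq_mul2l TT'.
Qed.

End Switching.

(** * The hypergraph of a system of matchings *)

Section Graph.
Variables (r n d : nat).
Implicit Types (w : system r n d) (i : 'I_r) (j : 'I_d) (x : 'I_n).
Implicit Types (X Y : {set vertex r n}).

(** The two sides differ by [(i' - i) * (j' - j)] up to sign, which is nonzero and smaller than
    [r * d] in absolute value. *)
Lemma cross_difference_mod i i' j j' : r * d <= n -> i != i' -> j != j' ->
  i * j + i' * j' != i * j' + i' * j %[mod n].
Proof.
have H (a b s t : nat) : 0 < s < r -> 0 < t < d -> r * d <= n ->
    a * b + (a + s) * (b + t) != a * (b + t) + (a + s) * b %[mod n].
  move=> /andP[s0 sr] /andP[t0 td] rdn; apply/negP => e.
  have : n %| s * t.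
    rewrite -(dvdn_addr (s * t) (dvdnn n)) /dvdn.
    move: e; rewrite (_ : _ * b + _ = a * (b + t) + (a + s) * b + s * t); last by lia.
    by rewrite -[X in _ == X %[mod _]]addn0 eqn_modDl mod0n modnDl.
  have st : 0 < s * t by rewrite muln_gt0 s0.
  by move=> /(dvdn_leq st); nia.
move=> rdn; rewrite -!val_eqE/= => ii' jj'.
have := ltn_ord i; have := ltn_ord i'; have := ltn_ord j; have := ltn_ord j'.
wlog ltii' : i i' ii' / i < i' => [wl|jd' jd ir' ir].
  case: (ltngtP i i') ii' => // [lt _|lt _]; first by apply: wl => //; rewrite neq_ltn lt.
  move=> jd' jd ir' ir; rewrite addnC [X in _ != X %[mod _]]addnC eq_sym.
  by apply: wl => //; rewrite neq_ltn lt.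
case: (ltngtP j j') jj' => // [lt _|lt _].
  have := H i j (i' - i) (j' - j); rewrite !subnKC ?(ltnW lt) ?(ltnW ltii')//.
  by apply => //; lia.
have := H i j' (i' - i) (j - j'); rewrite !subnKC ?(ltnW lt) ?(ltnW ltii')//.
by rewrite eq_sym; apply => //; lia.
Qed.

(* The witness is [(x, x + j, x + 2 j, ...)] modulo [n], for the label [x] of
   the [j]-th matching. *)
Lemma admissible_neq0 : 0 < n -> r * d <= n -> 0 < #|@admissible r n d|.
Proof.
move=> n0 rdn; pose shift k x := Ordinal (ltn_pmod (x + k) n0).
have shift_inj k : injective (shift k).
  move=> x y [] /eqP; rewrite eqn_modDr !modn_small// => /eqP; exact: val_inj.
apply/card_gt0P; exists [ffun q : 'I_d * 'I_r => perm (@shift_inj (q.2 * q.1)%N)].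
apply/admissibleP => j j' i i' z z' jj' ii'; rewrite !ffunE !permE.
move=> /(congr1 val)/= e /(congr1 val)/= e'.
have /negP[] := cross_difference_mod rdn ii' jj'.
(* Adding the two congruences crosswise lets [z] and [z'] cancel. *)
have : (z + i * j) + (z' + i' * j') = (z' + i * j') + (z + i' * j) %[mod n].
  by rewrite -modnDm e -e' modnDm.
by rewrite addnACA [X in _ = X %[mod _]]addnACA [z' + z]addnC => /eqP; rewrite eqn_modDl.
Qed.

Definition edge w j x : {set vertex r n} :=
  [set v : vertex r n | v.2 == w (j, v.1) x].

Definition graph w : hypergraph r n :=
  [set edge w q.1 q.2 | q : 'I_d * 'I_n].

Definition class X i : {set 'I_n} := [set a | (i, a) \in X].

Lemma card_part X i : #|part X i| = #|class X i|.
Proof.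
rewrite -[RHS](card_imset _ (_ : injective (pair i : 'I_n -> vertex r n))).
  2: by move=> a b [].
apply: eq_card => -[i' a]; rewrite !inE/=; apply/andP/imsetP => [[aX /eqP e]|].
  by rewrite e in aX *; exists a; rewrite ?inE.
by move=> [b]; rewrite inE => bX [-> ->].
Qed.

Lemma mem_edge w j x v : (v \in edge w j x) = (x == label w v.1 (j, v.2)).
Proof.
by rewrite inE /label/=; apply/eqP/eqP => ->; rewrite ?permK ?permKV.
Qed.

Lemma graph_partite w : partite (graph w).
Proof.
move=> _ /imsetP[q _ ->] i; rewrite card_part -(cards1 (w (q.1, i) q.2)).
by apply: eq_card => a; rewrite !inE.
Qed.

Lemma graph_simple w : w \in admissible r n d -> simple_hypergraph (graph w).
Proof.
move=> /admissibleP wA _ _ /imsetP[[j x] _ ->] /imsetP[[j' x'] _ ->] /= ne.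
apply/card_le1_eqP => -[i a] [i' b]; rewrite !inE/=.
move=> /andP[/eqP-> /eqP e] /andP[/eqP-> /eqP e'].
have [->//|ii'] := eqVneq i i'.
have [jj'|jj'] := eqVneq j j'; last by have := wA j j' i i' x x' jj' ii' e e'.
by move: ne e; rewrite jj' => + /perm_inj e; rewrite e eqxx.
Qed.

(** Each matching has one edge through a given vertex. For different matchings these edges differ:
    if equal, they would also share a vertex in a second class, which admissibility excludes. *)
Lemma graph_regular w : 2 <= r -> w \in admissible r n d ->
  regular d (graph w).
Proof.
move=> r2 /admissibleP wA [i a]; rewrite /degree.
pose f j := edge w j (label w i (j, a)).
have f_inj : injective f.
  move=> j j' ff; apply/eqP; apply: contraT => jj'.
  have [i' ii'] : exists i', i != i'.
    have [e|ne] := eqVneq i (Ordinal (ltnW r2)); last by exists (Ordinal (ltnW r2)).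
    by exists (Ordinal r2); rewrite e.
  exfalso; apply: (wA j j' i i' (label w i (j, a)) (label w i (j', a)) jj' ii').
    by rewrite /label !permKV.
  move/setP/(_ (i', w (j, i') (label w i (j, a)))): ff.
  by rewrite !inE/= eqxx => /esym/eqP.
rewrite -[RHS]card_ord -cardsT -(card_imset _ f_inj); apply: eq_card => e.
rewrite inE; apply/andP/imsetP => [[/imsetP[[j x] _ ->]]|[j _ ->]].
  by rewrite mem_edge/= => /eqP->; exists j.
by split; [apply/imsetP; exists (j, label w i (j, a))|rewrite mem_edge].
Qed.

Lemma edge_subset w i0 p Y :
  (edge w p.1 (label w i0 p) \subset Y) =
  (p.2 \in class Y i0) && edge_in w i0 (class Y) p.
Proof.
apply/subsetP/andP => [YP|[p0 /forallP Yp] [i a]].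
  split; last first.
    by apply/forallP => i; apply/implyP => _; rewrite inE YP// inE.
  by rewrite inE YP// mem_edge/= -surjective_pairing.
rewrite inE/= => /eqP->; have [->|ii0] := eqVneq i i0.
  by rewrite /label permKV; move: p0; rewrite inE.
by have := Yp i; rewrite ii0 inE.
Qed.

Lemma independent_none_in w i0 X (T : {set 'I_d * 'I_n}) :
  w \in admissible r n d -> independent (graph w) X ->
  (forall p, p \in T -> p.2 \in class X i0) -> w \in none_in i0 (class X) T.
Proof.
move=> wA indX TX; rewrite inE wA; apply/forallP => p; apply/implyP => pT.
have : edge w p.1 (label w i0 p) \in graph w.
  by apply/imsetP; exists (p.1, label w i0 p).
by move=> /indX; rewrite edge_subset TX.
Qed.

(** Each vertex of [Y] in the class [i0] lies on at least [k] edges inside [Y], from different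
    matchings. The set of these incidences is cut down to an exact size for the later union bound
    over [T]. *)
Lemma min_degree_all_in w i0 Y k :
  w \in admissible r n d ->
  (forall v, v \in Y -> k <= degree (induced (graph w) Y) v) ->
  exists T : {set 'I_d * 'I_n},
    [/\ T \subset setX setT (class Y i0), #|T| = #|class Y i0| * k
      & w \in all_in i0 (class Y) T].
Proof.
move=> wA Yk.
pose T0 := [set p | edge w p.1 (label w i0 p) \subset Y].
have : #|class Y i0| * k <= #|T0|.
  rewrite -sum_nat_const.
  apply: (@leq_trans (\sum_(v in class Y i0) #|[set j | (j, v) \in T0]|)).
    apply: leq_sum => v; rewrite inE => /Yk /leq_trans; apply.
    rewrite /degree; pose f j := edge w j (label w i0 (j, v)).
    apply: leq_trans (leq_imset_card f _).
    apply/subset_leq_card/subsetP => e; rewrite !inE.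
    move=> /andP[/andP[/imsetP[[j x] _ ->/=]]].
    rewrite mem_edge/= => eY /eqP xE; apply/imsetP; exists j; last by rewrite /f xE.
    by rewrite !inE/= -xE.
  under eq_bigr do rewrite -sum1_card.
  rewrite (exchange_big_dep predT)//= pair_big_dep/= sum1_card.
  by apply/subset_leq_card/subsetP => -[j v] /andP[_]; rewrite !inE.
case/card_geqP => s [s_uniq sT0 sT]; exists [set p in s]; split.
- apply/subsetP => p; rewrite inE => /sT; rewrite inE edge_subset => /andP[pY _].
  by rewrite !inE; move: pY; rewrite inE.
- by rewrite cardsE (card_uniqP s_uniq).
- rewrite inE wA; apply/forallP => p; apply/implyP; rewrite inE => /sT.
  by rewrite inE edge_subset => /andP[].
Qed.

End Graph.

(** * Class sizes and the product of all but the largest *)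

Section Profile.
Variables (r n : nat).
Implicit Types (X Y : {set vertex r n}).

Lemma imaxP X : 0 < r -> exists i0 : 'I_r,
  (forall i, #|class X i| <= #|class X i0|) /\
  prod_others X = \prod_(i | i != i0) #|class X i|.
Proof.
move=> r0; set p := fun i : 'I_r => #|part X i| == \max_(j < r) #|part X j|.
have has_p : has p (enum 'I_r).
  have [|i _ iE] := @eq_bigmax_cond _ predT (fun i : 'I_r => #|part X i|).
    by rewrite card_ord.
  by apply/hasP; exists i; rewrite ?mem_enum// /p iE.
pose i0 := nth (Ordinal r0) (enum 'I_r) (find p (enum 'I_r)).
have i0E : i0 = imax X :> nat.
  by rewrite /i0 nth_enum_ord// -[r in _ < r]card_ord cardE -has_find.
exists i0; split=> [i|].
  rewrite -!card_part; have /eqP-> := nth_find (Ordinal r0) has_p.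
  exact: (leq_bigmax (F := fun i : 'I_r => #|part X i|)).
rewrite /prod_others -i0E; apply: eq_big => [i|i _]; last exact: card_part.
by rewrite val_eqE.
Qed.

Lemma card_classes X : #|X| = \sum_i #|class X i|.
Proof.
under eq_bigr do rewrite -sum1_card.
rewrite pair_big_dep/= -sum1_card; apply: eq_bigl => -[i a].
by rewrite inE.
Qed.

Lemma class_mono X Y i : Y \subset X -> #|class Y i| <= #|class X i|.
Proof.
by move=> /subsetP YX; apply/subset_leq_card/subsetP => a; rewrite !inE; exact: YX.
Qed.

(** Omitting a largest factor leaves the smallest product, so for [Y] the index omitted for [X] can
    be used instead. *)
Lemma prod_others_mono X Y : 0 < r -> Y \subset X ->
  prod_others Y <= prod_others X.
Proof.
move=> r0 YX; have [i [_ ->]] := imaxP X r0; have [j [jmax ->]] := imaxP Y r0.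
apply: (@leq_trans (\prod_(k | k != i) #|class Y k|)); last first.
  by apply: leq_prod => k _; exact: class_mono.
have [->//|ij] := eqVneq i j.
rewrite (bigD1 i)//= [leqRHS](bigD1 j)/=; last by rewrite eq_sym.
by rewrite leq_mul//; apply/eq_leq/eq_bigl => k; rewrite andbC.
Qed.

End Profile.

(** * Counting the systems that are bad for a fixed set *)

Section BadEvents.
Variables (r n d : nat).
Implicit Types (X Y : {set vertex r n}).

Definition bad_I X : {set system r n d} :=
  [set w in admissible r n d | [forall (e | e \in graph w), ~~ (e \subset X)]].

Definition bad_D k Y : {set system r n d} :=
  [set w in admissible r n d |
    [forall (v | v \in Y), k <= degree (induced (graph w) Y) v]].

(** Here [t] edges are exposed and each lies in [X] with conditional probability at least [b / N];
    the third bound makes [b * t / N] proportional to [#|X|]. *)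
Lemma card_bad_I X : 2 <= r -> 0 < n -> 4 * r ^ 2 * d ^ 2 <= n ->
  n ^ r.-1 <= d * prod_others X ->
  exists b t, let N := 2 ^ r * n ^ r.-1 in
   [/\ #|bad_I X| * N ^ t <= #|admissible r n d| * (N - b) ^ t, b <= N,
     d * prod_others X * #|X| <= 8 * r * b * t & n <= d * #|X|].
Proof.
move=> r2 n0 dn Xbig; have r0 : 0 < r by exact: ltnW.
have [im [immax imE]] := imaxP X r0.
(* Edges are exposed at a smallest class, so that a bounded proportion of every
   class survives all the exposures. *)
have [i1 i1im] : exists i1, i1 != im.
  have [e|ne] := eqVneq (Ordinal r0) im; last by exists (Ordinal r0).
  by exists (Ordinal r2); rewrite -e.
have [i0 i0im i0min] : exists2 i0, i0 != im & forall i, #|class X i0| <= #|class X i|.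
  case: (@arg_minnP _ i1 (fun i => i != im) (fun i => #|class X i|) i1im) => i0 i0im i0min.
  exists i0 => // i; have [->|] := eqVneq i im; [exact: immax|exact: i0min].
set s := #|class X i0|.
(* All factors of [prod_others X] other than [s] are at most [n], so a large product forces even the
   smallest class to be large. *)
have sn : n <= d * s.
  have : prod_others X <= s * n ^ r.-2.
    rewrite imE (bigD1 i0)//= leq_mul2l; apply/orP; right.
    apply: (@leq_trans (\prod_(i | (i != im) && (i != i0)) n)).
      by apply: leq_prod => i _; rewrite -[leqRHS]card_ord max_card.
    rewrite prod_nat_const leq_pexp2l//.
    have := cardD1 i0 (predC1 im); rewrite cardC1 card_ord inE i0im add1n => ->.
    by apply/eq_leq/eq_card => i; rewrite !inE andbC.
  move=> /(leq_mul (leqnn d))/(leq_trans Xbig).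
  by case: r r2 => // -[] // q _ /=; rewrite expnS mulnA leq_pmul2r ?expn_gt0 ?n0.
have s4 : 4 * r ^ 2 * d <= s.
  have [d0|d0] := posnP d; first by rewrite d0 muln0.
  by rewrite -(leq_pmul2l d0) (leq_trans _ sn)// (leq_trans _ dn)// [d * _]mulnC -mulnA mulnn.
have d0 : 0 < d by case: d sn => //; rewrite mul0n leqNgt n0.
have [U [Us UX]] : exists U : {set 'I_n}, #|U| = s %/ 4 /\ U \subset class X i0.
  have /card_geqP[l [ul sl lX]] : s %/ 4 <= #|class X i0| by exact: leq_div.
  exists [set x in l]; split; first by rewrite cardsE (card_uniqP ul).
  by apply/subsetP => x; rewrite inE => /lX.
pose T := setX [set: 'I_d] U.
exists (\prod_(i | i != i0) #|class X i|), #|T| => N; split.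
- apply: leq_trans (@card_none_in r n d i0 (class X) T _ _); last first.
  + by move=> i _; exact: leq_trans s4 (i0min i).
  + move=> j i _; apply: leq_trans (i0min i).
    rewrite (_ : [set v | _] = U); last by apply/setP => v; rewrite !inE.
    by rewrite Us mulnC leq_trunc_div.
  rewrite leq_mul2r; apply/orP; right; apply/subset_leq_card/subsetP => w.
  rewrite inE => /andP[wA /forallP wX]; apply: independent_none_in => //.
    by move=> e eG; have := wX e; rewrite eG.
  by move=> p; rewrite inE => /andP[_ /(subsetP UX)].
- rewrite /N (@leq_trans (n ^ r.-1))//; last by rewrite leq_pmull// expn_gt0.
  rewrite -(prod_classesT n i0); apply: leq_prod => i _.
  by apply: subset_leq_card; exact: subsetT.
- have : #|X| <= r * #|class X im|.
    rewrite card_classes (leq_trans (leq_sum (index_enum _) (fun i _ => immax i)))//.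
    by rewrite sum_nat_const card_ord.
  (* Both sides are the product of all class sizes. *)
  have : (\prod_(i | i != i0) #|class X i|) * s = prod_others X * #|class X im|.
    have prodD1 i : \prod_(k | k != i) #|class X k| * #|class X i| = \prod_k #|class X k|.
      by rewrite [RHS](bigD1 i)//= mulnC.
    by rewrite imE !prodD1.
  (* From 4 on, rounding [s / 4] down costs at most a factor 2. *)
  have : s <= 8 * (s %/ 4) by have : 4 <= s; [nia|lia].
  rewrite cardsX cardsT card_ord Us.
  move: (\prod_(i | i != i0) _) (prod_others X) #|X| #|class X im| (s %/ 4).
  move=> b p x m u su bs xm.
  apply: (@leq_trans (d * p * (r * m))); first by rewrite leq_mul2l xm orbT.
  have -> : d * p * (r * m) = d * r * (b * s) by rewrite bs; lia.
  have -> : 8 * r * b * (d * u) = d * r * (b * (8 * u)) by lia.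
  by rewrite !leq_mul.
- by rewrite (leq_trans sn)// leq_mul2l card_classes (bigD1 i0)//= leq_addr orbT.
Qed.

(** A union bound over the sets [T] of [m * k] incidences at the largest class whose edges all lie
    in [Y]. *)
Lemma card_bad_D k Y m : 2 <= r -> 4 * r ^ 2 * d <= n -> 4 ^ r.-1 <= d ->
  d * prod_others Y < n ^ r.-1 ->
  m = \max_i #|class Y i| ->
  #|bad_D k Y| * (n ^ r.-1) ^ (m * k) <=
  #|admissible r n d| * 'C(d * m, m * k) * (2 ^ r * prod_others Y) ^ (m * k).
Proof.
move=> r2 dn d4 Ysmall mE; have r0 : 0 < r by exact: ltnW.
have [im [immax imE]] := imaxP Y r0.
have {}mE : m = #|class Y im|.
  apply/eqP; rewrite mE eqn_leq leq_bigmax andbT; exact/bigmax_leqP.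
have [i1 i1im] : exists i1, i1 != im.
  have [e|ne] := eqVneq (Ordinal r0) im; last by exists (Ordinal r0).
  by exists (Ordinal r2); rewrite -e.
(* The smallest class works: the power [r.-1] of four times its size is at most
   [4 ^ r.-1 * prod_others Y], hence at most [d * prod_others Y], which is below [n ^ r.-1]. *)
have [i0 i0im i0small] : exists2 i0, i0 != im & 4 * #|class Y i0| <= n.
  case: (@arg_minnP _ i1 (fun i => i != im) (fun i => #|class Y i|) i1im) => i0 i0im i0min.
  exists i0 => //; have rp : 0 < r.-1 by case: r r2 => // -[].
  rewrite -(leq_exp2r _ _ rp) expnMn (leq_trans _ (ltnW Ysmall))// leq_mul// imE.
  apply: leq_trans (leq_prod i0min); rewrite prod_nat_const.
  by have := cardC1 im; rewrite card_ord => <-.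
pose Ts := [set T : {set 'I_d * 'I_n} | (T \subset setX setT (class Y im))
                                        && (#|T| == m * k)].
have : #|bad_D k Y| <= \sum_(T in Ts) #|all_in im (class Y) T|.
  apply: card_union_bound => w; rewrite inE => /andP[wA /forallP wY].
  have [v vY|T [TY Tm wT]] := @min_degree_all_in r n d w im Y k wA.
    by have := wY v; rewrite vY.
  by exists T => //; rewrite inE TY Tm -mE eqxx.
move=> /leq_mul/(_ (leqnn ((n ^ r.-1) ^ (m * k))))/leq_trans; apply.
rewrite big_distrl/=.
apply: (@leq_trans (\sum_(T in Ts) #|admissible r n d| * (2 ^ r * prod_others Y) ^ (m * k))).
  apply: leq_sum => T; rewrite inE => /andP[_ /eqP <-].
  by rewrite imE; exact: card_all_in i0im i0small dn.
by rewrite sum_nat_const cards_draws cardsX cardsT card_ord -mE mulnCA mulnA.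
Qed.

End BadEvents.

(** * Estimates *)

Local Open Scope ring_scope.

Section Estimates.
Variable R : realType.
Implicit Types (z L x : R).

(** The left side is a single term in the expansion of [(1 + z) ^+ N]. *)
Lemma binomial_expR_le (N K : nat) z : 0 <= z ->
  'C(N, K)%:R * z ^+ K <= expR (z * N%:R).
Proof.
move=> z0; have [KN|NK] := leqP K N; last first.
  by rewrite bin_small// mul0r expR_ge0.
apply: (@le_trans _ _ ((1 + z) ^+ N)).
  rewrite exprDn (bigD1 (inord K))//= inordK ?ltnS// expr1n mul1r mulr_natl lerDl.
  by apply: sumr_ge0 => i _; rewrite expr1n mul1r mulrn_wge0// exprn_ge0.
rewrite expRM_natr lerXn2r// ?nnegrE ?expR_ge0 ?addr_ge0//.
exact: expR_ge1Dx.
Qed.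

Lemma sum_subsets_expR_le (T : finType) z : 0 <= z ->
  \sum_(Y : {set T}) z ^+ #|Y| <= expR (z * #|T|%:R).
Proof.
move=> z0; apply: (@le_trans _ _ ((z + 1) ^+ #|T|)).
  rewrite -prodr_const.
  rewrite (_ : \prod_(i in T) _ = \prod_(i : T) ((fun=> z) i + (fun=> 1) i))//.
  rewrite bigA_distr/=; apply: ler_sum => Y _.
  by rewrite -big_mkcond/= prodr_const.
rewrite expRM_natr lerXn2r// ?nnegrE ?expR_ge0 ?addr_ge0// addrC.
exact: expR_ge1Dx.
Qed.

Lemma sum_geometric4_le (n : nat) :
  \sum_(m < n.+1 | (0 < m)%N) (4%:R^-1 : R) ^+ m <= 3%:R^-1.
Proof.
suff -> : \sum_(m < n.+1 | (0 < m)%N) (4%:R^-1 : R) ^+ m =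
          3%:R^-1 * (1 - 4%:R^-1 ^+ n).
  have : 0 <= (4%:R^-1 : R) ^+ n by rewrite exprn_ge0// invr_ge0.
  lra.
elim: n => [|n IHn].
  by rewrite big_mkcond big_ord1/= expr0 subrr mulr0.
by rewrite big_mkcond big_ord_recr/= -big_mkcond IHn exprS; field.
Qed.

(** To be used with [x = ln (ln d)], where [expR (2 * expR x)] is [d ^ 2]. The base is at most
    [expR (- 3x/4)] and [k * x >= 4 * expR x], so the left side is at most [expR (- expR x)]. *)
Lemma degeneracy_estimate (r : nat) x (k : nat) :
  8 * (1 + r%:R) <= x -> 4 * expR x / x <= k%:R ->
  (expR 1 * 2 ^+ r / k%:R) ^+ k * expR (2 * expR x) <= expR (- r%:R) / 4.
Proof.
move=> xr; set b := 1 + r%:R in xr * => kx.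
have r0 : 0 <= r%:R :> R by [].
have x0 : 0 < x by rewrite /b in xr; lra.
(* This is [(1 + a) ^ 2 >= 4 * a] with [a = x / 16]. *)
have e8 : x / 4 <= expR (x / 8).
  have := expR_ge1Dx (x / 16); rewrite (_ : x / 8 = x / 16 + x / 16); last by field.
  rewrite expRD => h; have : (1 + x / 16) * (1 + x / 16) <= expR (x / 16) * expR (x / 16).
    by rewrite ler_pM//; lra.
  have := sqr_ge0 (1 - x / 16); rewrite expr2; lra.
(* Of [expR x], one factor [expR (x / 8)] pays for [expR b] and another for the division by
   [x / 4]. *)
have k34 : expR (b + 3 / 4 * x) <= k%:R.
  apply: le_trans kx; rewrite ler_pdivlMr//.
  have -> : expR x = expR (3 / 4 * x) * expR (x / 8) * expR (x / 8).
    by rewrite -!expRD; congr expR; field.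
  have eb : expR b <= expR (x / 8) by rewrite ler_expR; lra.
  rewrite expRD; have := expR_gt0 (3 / 4 * x); move: (expR (3 / 4 * x)) => c c0.
  have := expR_gt0 b => eb0.
  have : expR b * (x / 4) <= expR (x / 8) * expR (x / 8) by rewrite ler_pM// ltW//; lra.
  move: (expR (x / 8)) (expR b) => u v; nra.
have k0 : 0 < k%:R :> R by apply: lt_le_trans k34; exact: expR_gt0.
have base : expR 1 * 2 ^+ r / k%:R <= expR (- (3 / 4 * x)).
  rewrite ler_pdivrMr// (@le_trans _ _ (expR b))//.
    rewrite expRD ler_pM// ?expR_ge0 ?exprn_ge0//.
    rewrite -[X in expR X]mul1r expRM_natr lerXn2r ?nnegrE ?expR_ge0//.
    by have := expR_ge1Dx (1 : R).
  rewrite expRN mulrC ler_pdivlMr ?expR_gt0// -expRD.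
  by [].
have kx4 : 4 * expR x <= k%:R * x by rewrite -ler_pdivrMr.
apply: (@le_trans _ _ (expR (- (3 / 4 * x)) ^+ k * expR (2 * expR x))).
  rewrite ler_wpM2r ?expR_ge0// lerXn2r ?nnegrE ?expR_ge0//.
  by rewrite divr_ge0 ?mulr_ge0 ?expR_ge0 ?exprn_ge0 ?ler0n.
rewrite -expRM_natr -expRD.
have e4 : 4 <= expR 2 :> R.
  rewrite (_ : 2 = 1 + 1 :> R)// expRD; have := expR_ge1Dx (1 : R).
  move: (expR 1) => u; nra.
apply: (@le_trans _ _ (expR (- r%:R - 2))); last first.
  rewrite expRD ler_wpM2l ?expR_ge0// expRN lef_pV2// ?posrE//.
  exact: expR_gt0.
rewrite ler_expR; have := expR_ge1Dx x; rewrite /b in xr; nra.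
Qed.

End Estimates.

(** * Summing the bounds over all sets *)

Section Bounds.
Variables (R : realType) (r n d : nat).
Hypotheses (r2 : (2 <= r)%N) (n0 : (0 < n)%N) (d0 : (0 < d)%N).
Implicit Types (X Y : {set vertex r n}) (L : R).

(** From [(1 - b / N) ^ t <= expR (- b * t / N)]; the constant [r * 2 ^ (r + 3)] combines the
    [8 * r] of [card_bad_I] with the [2 ^ r] in [N]. *)
Lemma card_bad_I_le L X : (4 * r ^ 2 * d ^ 2 <= n)%N -> 1 <= L ->
  n%:R ^+ r.-1 / d%:R * L ^+ 2 <= (prod_others X)%:R ->
  #|bad_I d X|%:R <= #|admissible r n d|%:R *
    expR (- (L ^+ 2 / (r%:R * 2 ^+ (r + 3)) * #|X|%:R)) /\ (n <= d * #|X|)%N.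
Proof.
move=> dn L1 Xbig.
have r0 : 0 < r%:R :> R by rewrite ltr0n ltnW.
have nR0 : 0 < n%:R :> R by rewrite ltr0n.
have dR0 : 0 < d%:R :> R by rewrite ltr0n.
have {}Xbig : n%:R ^+ r.-1 * L ^+ 2 <= d%:R * (prod_others X)%:R.
  by move: Xbig; rewrite mulrAC ler_pdivrMr// [_ * d%:R]mulrC.
have XbigN : (n ^ r.-1 <= d * prod_others X)%N.
  rewrite -(ler_nat R) natrM natrX (le_trans _ Xbig)// ler_peMr ?exprn_ge0//.
  by rewrite exprn_ege1.
have [b [t /= [badX bN bt nX]]] := card_bad_I r2 n0 dn XbigN.
split=> //; set N := (2 ^ r * n ^ r.-1)%N in badX bN *.
have N0 : 0 < N%:R :> R by rewrite ltr0n muln_gt0 !expn_gt0 n0.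
have e1 : #|bad_I d X|%:R <= #|admissible r n d|%:R * (1 - b%:R / N%:R) ^+ t :> R.
  rewrite -(ler_pM2r (exprn_gt0 t N0)) -mulrA -exprMn mulrBl mul1r divfK ?gt_eqF//.
  by rewrite -natrB// -!natrX -!natrM ler_nat.
apply: (le_trans e1); rewrite ler_wpM2l//.
have q1 : 0 <= 1 - b%:R / N%:R :> R.
  by rewrite subr_ge0 ler_pdivrMr// mul1r ler_nat.
apply: (@le_trans _ _ (expR (- (b%:R / N%:R)) ^+ t)).
  by rewrite lerXn2r ?nnegrE ?expR_ge0//; exact: expR_ge1Dx.
rewrite -expRM_natr ler_expR mulNr lerN2.
have NE : N%:R = 2 ^+ r * n%:R ^+ r.-1 :> R by rewrite natrM !natrX.
have bt' : d%:R * (prod_others X)%:R * #|X|%:R <= 8 * r%:R * b%:R * t%:R :> R.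
  by rewrite -!natrM ler_nat.
rewrite [leRHS]mulrAC ler_pdivlMr// NE.
have -> : L ^+ 2 / (r%:R * 2 ^+ (r + 3)) * #|X|%:R * (2 ^+ r * n%:R ^+ r.-1) =
          n%:R ^+ r.-1 * L ^+ 2 * #|X|%:R / (8 * r%:R).
  rewrite exprD; have : 2 ^+ r != 0 :> R by rewrite expf_neq0 ?pnatr_eq0.
  by move: (2 ^+ r) => c c0; field; rewrite c0 gt_eqF.
rewrite ler_pdivrMr ?mulr_gt0// (le_trans (ler_wpM2r _ Xbig))//.
by rewrite (le_trans bt')// le_eqVlt; apply/orP; left; apply/eqP; ring.
Qed.

Lemma sum_bad_I_le L : (4 * r ^ 2 * d ^ 2 <= n)%N -> L = ln d%:R ->
  r%:R * 2 ^+ (r + 5) <= L -> (r <= d)%N ->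
  \sum_(X | n%:R ^+ r.-1 / d%:R * L ^+ 2 <= (prod_others X)%:R)
     #|@bad_I r n d X|%:R <= #|admissible r n d|%:R / 3 :> R.
Proof.
move=> dn LE Lbig rd; set W := #|admissible r n d|%:R.
have r0 : 0 < r%:R :> R by rewrite ltr0n ltnW.
have nR0 : 0 < n%:R :> R by rewrite ltr0n.
have dR0 : 0 < d%:R :> R by rewrite ltr0n.
have L2 : 2 <= L.
  rewrite (le_trans _ Lbig)// -[leLHS]mul1r ler_pM ?ler1n ?(ltnW r2)//.
  by rewrite -[leLHS]expr1 ler_eXn2l ?ltr1n// addnS.
set a := L ^+ 2 / (r%:R * 2 ^+ (r + 3)).
have aL : 4 * L <= a.
  rewrite /a ler_pdivlMr ?mulr_gt0 ?exprn_gt0// expr2 mulrAC.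
  have -> : 4 * (r%:R * 2 ^+ (r + 3)) = r%:R * 2 ^+ (r + 5) :> R.
    by rewrite !exprD; ring.
  by rewrite mulrC ler_wpM2l//; lra.
(* Half of the exponent is spent on [#|X| >= n / d]; the other half makes the sum over [X]
   converge. *)
apply: (@le_trans _ _ (\sum_(X : {set vertex r n})
    W * expR (- (a / 2 * (n%:R / d%:R))) * expR (- (a / 2)) ^+ #|X|)).
  rewrite [leLHS]big_mkcond; apply: ler_sum => X _; case: ifP => [Xbig|_]; last first.
    by rewrite !mulr_ge0 ?exprn_ge0 ?expR_ge0// ler0n.
  have [|badX nX] := card_bad_I_le dn _ Xbig; first by lra.
  apply: (le_trans badX); rewrite -[leRHS]mulrA ler_wpM2l ?ler0n//.
  rewrite -expRM_natr -expRD ler_expR -/a.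
  have : n%:R / d%:R <= #|X|%:R :> R by rewrite ler_pdivrMr// mulrC -natrM ler_nat.
  by nra.
rewrite -big_distrr/= -mulrA ler_wpM2l ?ler0n//.
apply: (le_trans (ler_wpM2l _ (sum_subsets_expR_le _ (expR_ge0 _)))).
  exact: expR_ge0.
rewrite card_prod !card_ord -expRD natrM.
have ed : expR (- (a / 2)) <= d%:R ^- 2.
  rewrite -[d%:R]lnK ?posrE// -LE -expRM_natr -expRN ler_expR; lra.
have rdR : r%:R <= d%:R :> R by rewrite ler_nat.
have h1 : expR (- (a / 2)) * (r%:R * n%:R) <= n%:R / d%:R.
  apply: (@le_trans _ _ (d%:R ^- 2 * (d%:R * n%:R))).
    by rewrite ler_pM ?expR_ge0 ?mulr_ge0 ?ler_wpM2r.
  by rewrite le_eqVlt; apply/orP; left; apply/eqP; field; rewrite gt_eqF.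
have nd1 : 1 <= n%:R / d%:R :> R.
  rewrite ler_pdivlMr// mul1r ler_nat (leq_trans _ dn)//.
  by have : (0 < r)%N by [exact: ltnW]; case: (r) d0 => // q; nia.
(* Since [a / 2 >= 4] and the sum over [X] costs at most [expR (n / d)], the exponent is at most
   [- 3 * n / d]. *)
apply: (@le_trans _ _ (expR (-2))).
  by rewrite ler_expR; nra.
rewrite expRN lef_pV2 ?posrE ?expR_gt0//.
by have := expR_ge1Dx (2 : R); lra.
Qed.

Lemma card_bad_D_le (k : nat) Y (m : nat) : (4 * r ^ 2 * d <= n)%N ->
  (4 ^ r.-1 <= d)%N -> (2 <= k)%N ->
  (expR 1 * 2 ^+ r / k%:R) ^+ k * d%:R ^+ 2 <= expR (- r%:R) / 4 :> R ->
  (prod_others Y)%:R < n%:R ^+ r.-1 / d%:R :> R ->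
  m = \max_i #|class Y i| ->
  #|bad_D d k Y|%:R <= #|admissible r n d|%:R *
     ((m%:R / n%:R) ^+ r * (expR (- r%:R) / 4)) ^+ m :> R.
Proof.
move=> dn d4 k2 kest Ysmall mE.
have nR0 : 0 < n%:R :> R by rewrite ltr0n.
have dR0 : 0 < d%:R :> R by rewrite ltr0n.
have kR0 : 0 < k%:R :> R by rewrite ltr0n ltnW.
have {}Ysmall : (d * prod_others Y < n ^ r.-1)%N.
  by rewrite -(ltr_nat R) natrM natrX mulrC -ltr_pdivlMr.
have := card_bad_D k r2 dn d4 Ysmall mE.
rewrite -(ler_nat R) !(natrM, natrX) => badY.
set p := (prod_others Y)%:R in badY.
pose delta : R := d%:R * p / n%:R ^+ r.-1.
have nr0 : 0 < n%:R ^+ r.-1 :> R by rewrite exprn_gt0.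
have delta0 : 0 <= delta by rewrite divr_ge0 ?mulr_ge0 ?ler0n ?exprn_ge0.
have delta1 : delta <= 1.
  by rewrite ler_pdivrMr// mul1r -natrX -natrM ler_nat ltnW.
have mn : (m <= n)%N.
  rewrite mE; apply/bigmax_leqP => i _.
  by rewrite -[leqRHS](card_ord n) max_card.
have pm : p <= m%:R ^+ r.-1.
  have [im [_ imE]] := imaxP Y (ltnW r2).
  rewrite /p imE -natrX ler_nat.
  apply: (@leq_trans (\prod_(i | i != im) m)).
    by apply: leq_prod => i _; rewrite mE (leq_bigmax (F := fun i => #|class Y i|)).
  rewrite prod_nat_const leq_eqVlt; apply/orP; left; apply/eqP; congr (_ ^ _)%N.
  by have := cardC1 im; rewrite card_ord.
have mn0 : 0 <= m%:R / n%:R :> R by rewrite divr_ge0.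
have mn1 : m%:R / n%:R <= 1 :> R by rewrite ler_pdivrMr// mul1r ler_nat.
have deltam : delta <= d%:R * (m%:R / n%:R) ^+ r.-1.
  by rewrite expr_div_n mulrA ler_wpM2r ?invr_ge0 ?exprn_ge0// ler_wpM2l.
(* The exponent [k >= 2] may be lowered to 2 because [delta <= 1], and then [2 * r.-1 >= r]. *)
have deltak : delta ^+ k <= d%:R ^+ 2 * (m%:R / n%:R) ^+ r.
  apply: (@le_trans _ _ (delta ^+ 2)).
    by rewrite ler_wiXn2l.
  apply: (@le_trans _ _ ((d%:R * (m%:R / n%:R) ^+ r.-1) ^+ 2)).
    rewrite lerXn2r// nnegrE; exact: le_trans deltam.
  rewrite exprMn ler_wpM2l ?exprn_ge0// -exprM ler_wiXn2l//.
  by case: r r2 => // -[] // q _; rewrite /=; lia.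
(* The choice [z = k / d] turns the exponent [z * (d * m)] into [m * k]. *)
have binom : 'C(d * m, m * k)%:R <= (expR 1 * d%:R / k%:R) ^+ (m * k) :> R.
  have := binomial_expR_le (d * m) (m * k) (_ : 0 <= k%:R / d%:R :> R).
  rewrite divr_ge0// => /(_ isT).
  have -> : k%:R / d%:R * (d * m)%:R = 1 * (m * k)%:R :> R.
    by rewrite !natrM; field; rewrite gt_eqF.
  rewrite expRM_natr -ler_pdivlMr ?exprn_gt0 ?divr_gt0// => /le_trans; apply.
  by rewrite -exprVn -exprMn invf_div mulrA.
apply: (@le_trans _ _ (#|admissible r n d|%:R *
    (expR 1 * d%:R / k%:R) ^+ (m * k) * (2 ^+ r * p / n%:R ^+ r.-1) ^+ (m * k))).
  rewrite -(ler_pM2r (exprn_gt0 (m * k) nr0)) (le_trans badY)//.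
  rewrite -[leRHS]mulrA -exprMn divfK ?gt_eqF// ler_wpM2r//.
    by rewrite exprn_ge0// mulr_ge0// ?exprn_ge0// ler0n.
  by rewrite ler_wpM2l// ler0n.
rewrite -mulrA ler_wpM2l ?ler0n// -exprMn mulnC exprM.
have c0 : 0 <= expR 1 * 2 ^+ r / k%:R :> R.
  by rewrite divr_ge0 ?mulr_ge0 ?expR_ge0 ?exprn_ge0 ?ler0n.
have -> : expR 1 * d%:R / k%:R * (2 ^+ r * p / n%:R ^+ r.-1) =
          expR 1 * 2 ^+ r / k%:R * delta.
  by rewrite /delta; field; rewrite !gt_eqF.
have q0 : 0 <= expR (- r%:R) / 4 :> R by rewrite divr_ge0// expR_ge0.
rewrite lerXn2r// ?nnegrE; [by rewrite exprn_ge0 // mulr_ge0|by rewrite mulr_ge0 // exprn_ge0|].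
rewrite exprMn (le_trans (ler_wpM2l _ deltak)) ?exprn_ge0//.
by rewrite mulrA mulrC ler_wpM2l ?exprn_ge0.
Qed.

Lemma sum_bad_D_le (k : nat) : (4 * r ^ 2 * d <= n)%N ->
  (4 ^ r.-1 <= d)%N -> (2 <= k)%N ->
  (expR 1 * 2 ^+ r / k%:R) ^+ k * d%:R ^+ 2 <= expR (- r%:R) / 4 :> R ->
  \sum_(Y : {set vertex r n} |
        (Y != finset.set0) && ((prod_others Y)%:R < n%:R ^+ r.-1 / d%:R :> R))
     #|@bad_D r n d k Y|%:R <= #|admissible r n d|%:R / 3 :> R.
Proof.
move=> dn d4 k2 kest; set W := #|admissible r n d|%:R.
have nR0 : 0 < n%:R :> R by rewrite ltr0n.
have W0 : 0 <= W by rewrite ler0n.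
pose M Y := \max_i #|class Y i|.
have MX Y i : (#|class Y i| <= M Y)%N by exact: (leq_bigmax (F := fun i => #|class Y i|)).
have Mn Y : (M Y < n.+1)%N.
  by rewrite ltnS; apply/bigmax_leqP => i _; rewrite -[leqRHS](card_ord n) max_card.
have M0 Y : Y != finset.set0 -> (0 < M Y)%N.
  move=> /finset.set0Pn[[i v] ivY]; apply: leq_trans (MX Y i).
  by apply/card_gt0P; exists v; rewrite inE.
have MY Y : (#|Y| <= r * M Y)%N.
  rewrite card_classes (leq_trans (leq_sum (index_enum _) (fun i _ => MX Y i)))//.
  by rewrite sum_nat_const card_ord.
rewrite (partition_big (fun Y => Ordinal (Mn Y)) (fun m => 0 < m)%N)/=; last first.
  by move=> Y /andP[Y0 _]; exact: M0.
apply: (@le_trans _ _ (\sum_(m < n.+1 | (0 < m)%N) W * 4^-1 ^+ m)); last first.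
  by rewrite -big_distrr/= ler_wpM2l// sum_geometric4_le.
apply: ler_sum => m m0.
have z0 : 0 <= m%:R / n%:R :> R by rewrite divr_ge0.
have z1 : m%:R / n%:R <= 1 :> R by rewrite ler_pdivrMr// mul1r ler_nat -ltnS.
(* As [#|Y| <= r * m], the power [(m / n) ^ (r * m)] is at most [(m / n) ^ #|Y|]. The sum over [Y]
   then gives at most [expR (r * m)], which the factor [expR (- r) ^ m] cancels. *)
apply: (@le_trans _ _ (\sum_(Y : {set vertex r n})
   W * (expR (- r%:R) / 4) ^+ m * (m%:R / n%:R) ^+ #|Y|)).
  rewrite [leLHS]big_mkcond; apply: ler_sum => Y _; case: ifP; last first.
    by rewrite !mulr_ge0 ?exprn_ge0 ?divr_ge0 ?expR_ge0// ler0n.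
  move=> /andP[/andP[Y0 Ysmall] /eqP/(congr1 val)/= mE].
  apply: le_trans (card_bad_D_le dn d4 k2 kest Ysmall (esym mE)) _.
  rewrite -mulrA ler_wpM2l// exprMn mulrC ler_wpM2l ?exprn_ge0 ?divr_ge0 ?expR_ge0//.
  by rewrite -exprM ler_wiXn2l// -mE MY.
rewrite -big_distrr/= -mulrA ler_wpM2l//.
apply: le_trans (ler_wpM2l _ (sum_subsets_expR_le _ z0)) _.
  by rewrite exprn_ge0// divr_ge0// expR_ge0.
rewrite card_prod !card_ord.
have -> : m%:R / n%:R * (r * n)%:R = r%:R * m%:R :> R.
  by rewrite natrM; field; rewrite gt_eqF.
rewrite exprMn mulrAC -expRM_natr -expRD mulNr addNr expR0 mul1r.
by [].
Qed.

End Bounds.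

(** * Choice of a good system and of the constants *)

(** Each of the two bad families covers at most a third of the admissible systems, of which there is
    at least one. *)
Lemma exists_hypergraph (R : realType) (r n d k : nat) :
  (2 <= r)%N -> (0 < n)%N -> (0 < d)%N -> (r * d <= n)%N ->
  (4 * r ^ 2 * d ^ 2 <= n)%N -> (r <= d)%N -> (4 ^ r.-1 <= d)%N -> (2 <= k)%N ->
  r%:R * 2 ^+ (r + 5) <= ln d%:R :> R ->
  (expR 1 * 2 ^+ r / k%:R) ^+ k * d%:R ^+ 2 <= expR (- r%:R) / 4 :> R ->
  exists w : system r n d, w \in admissible r n d /\
    property_I (d%:R : R) (graph w) /\
    (forall X, (prod_others X)%:R < n%:R ^+ r.-1 / d%:R :> R ->
       forall Y : {set vertex r n}, Y \subset X -> Y != set0 ->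
         exists2 v, v \in Y & (degree (induced (graph w) Y) v < k)%N).
Proof.
move=> r2 n0 d0 rdn dn rd d4 k2 lnd kest.
have dn1 : (4 * r ^ 2 * d <= n)%N.
  by rewrite (leq_trans _ dn)// leq_mul2l -mulnn leq_pmulr ?orbT.
set W := admissible r n d.
pose cI (X : {set vertex r n}) :=
  n%:R ^+ r.-1 / d%:R * ln d%:R ^+ 2 <= (prod_others X)%:R :> R.
pose cD (Y : {set vertex r n}) :=
  (Y != set0) && ((prod_others Y)%:R < n%:R ^+ r.-1 / d%:R :> R).
pose good (w : system r n d) := [forall X, cI X ==> (w \notin bad_I d X)] &&
                                [forall Y, cD Y ==> (w \notin bad_D d k Y)].
have [w wW /andP[/forallP wI /forallP wD]] : exists2 w, w \in W & good w.
  apply/exists_inP; apply: contraT => /exists_inPn nogood.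
  have : (#|W| <= \sum_(X | cI X) #|bad_I d X| + \sum_(Y | cD Y) #|bad_D d k Y|)%N.
    rewrite -(cardsID (\bigcup_(X | cI X) bad_I d X) W) leq_add//.
      by apply: card_union_bound => w /setIP[_ /bigcupP[X cX wX]]; exists X.
    apply: card_union_bound => w /setDP[wW /bigcupP wnI].
    have := nogood w wW; rewrite negb_and => /orP[|].
      rewrite negb_forall => /existsP[X]; rewrite negb_imply negbK => /andP[cX wX].
      by case: wnI; exists X.
    by rewrite negb_forall => /existsP[Y]; rewrite negb_imply negbK => /andP[cY wY]; exists Y.
  rewrite -(ler_nat R) natrD !natr_sum => /le_trans/(_ (lerD
    (sum_bad_I_le r2 n0 d0 dn erefl lnd rd) (sum_bad_D_le r2 n0 d0 dn1 d4 k2 kest))).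
  have : 0 < #|W|%:R :> R by rewrite ltr0n admissible_neq0.
  rewrite -/W; lra.
exists w; split=> //; split.
  move=> X indX; rewrite ltNge; apply/negP => cX.
  have := wI X; rewrite /cI cX/= => /negP[]; rewrite inE wW.
  by apply/forallP => e; apply/implyP; exact: indX.
move=> X Xsmall Y YX Y0; apply/exists_inP; apply: contraT => /exists_inPn Yk.
have := wD Y; rewrite /cD Y0/= (le_lt_trans _ Xsmall)/=; last first.
  by rewrite ler_nat prod_others_mono// ltnW.
move=> /negP[]; rewrite inE wW; apply/forallP => v; apply/implyP => vY.
by rewrite leqNgt Yk.
Qed.

Theorem theorem1p4 (R : realType) (r : nat) (hr : (2 <= r)%N) :
  exists d0 : nat, forall d n : nat,
    (d0 <= d)%N -> (r ^ 5 * d ^ 4 <= n)%N ->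
    exists G : hypergraph r n,
      [/\ partite G, simple_hypergraph G, regular d G,
          property_I (d%:R : R) G & property_D (d%:R : R) G].
Proof.
(* The first summand gives [ln (ln d) >= 8 * (1 + r)] for [degeneracy_estimate], the second the
   lower bound on [ln d] in [exists_hypergraph]. *)
pose L0 : R := expR (8 * (1 + r%:R)) + r%:R * 2 ^+ (r + 5).
exists (maxn (4 ^ r) (Num.truncn (expR L0)).+1) => d n.
rewrite geq_max => /andP[rd Ld] dn.
have d0 : (0 < d)%N by apply: leq_trans rd; rewrite expn_gt0.
have dR0 : 0 < d%:R :> R by rewrite ltr0n.
have r0 : (0 < r)%N by exact: ltnW.
set L := ln (d%:R : R); set x := ln L.
have L0L : L0 <= L.
  rewrite -[L0]expRK ler_ln ?posrE ?expR_gt0//.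
  by rewrite (le_trans (ltW (truncnS_gt _)))// ler_nat.
have eL : expR (8 * (1 + r%:R)) <= L.
  by rewrite (le_trans _ L0L)// lerDl mulr_ge0// exprn_ge0.
have L_gt0 : 0 < L by apply: lt_le_trans eL; exact: expR_gt0.
have xr : 8 * (1 + r%:R) <= x by rewrite -[leLHS]expRK ler_ln ?posrE ?expR_gt0.
have xL : expR x = L by rewrite lnK.
have Ld' : expR L = d%:R by rewrite lnK.
have r0R : 0 <= r%:R :> R by [].
have x0 : 0 < x by lra.
(* The least integer above [4 * L / x], so that a degree below [k] is at most [4 * L / x]. *)
set k := (Num.truncn (4 * L / x)).+1.
have kx : 4 * expR x / x <= k%:R by rewrite xL ltW// truncnS_gt.
have k2 : (2 <= k)%N.
  rewrite -(ler_nat R) (le_trans _ kx)// ler_pdivlMr//.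
  by have := expR_ge1Dx x; lra.
have kest := degeneracy_estimate xr kx.
rewrite xL [2 * L]mulrC expRM_natr Ld' in kest.
have big : (4 * r ^ 2 * d ^ 2 <= n)%N.
  apply: leq_trans dn; rewrite (expnD r 3 2) (expnD d 2 2) mulnA leq_mul2r.
  apply/orP; right; rewrite mulnAC leq_mul2r; apply/orP; right.
  have : (2 ^ 3 <= r ^ 3)%N by rewrite leq_exp2r.
  have : (0 < d ^ 2)%N by rewrite expn_gt0 d0.
  nia.
have [] := @exists_hypergraph R r n d k hr _ d0 _ big _ _ k2 _ _ => //.
- by apply: leq_trans dn; rewrite muln_gt0 !expn_gt0 r0 d0.
- by apply: leq_trans big; nia.
- by apply: leq_trans rd; apply: ltnW; exact: ltn_expl.
- by apply: leq_trans rd; rewrite leq_pexp2l// leq_pred.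
- by rewrite (le_trans _ L0L)// lerDr expR_ge0.
move=> w [wA [wI wD]]; exists (graph w); split=> //.
- exact: graph_partite.
- exact: graph_simple.
- exact: graph_regular.
move=> X Xsmall Y YX Y0; have [v vY vk] := wD X Xsmall Y YX Y0.
exists v => //; rewrite -/L -/x.
apply: le_trans (_ : (Num.truncn (4 * L / x))%:R <= _); first by rewrite ler_nat.
by rewrite truncn_le// divr_ge0 ?mulr_ge0// ltW.
Qed.
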